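(* Let $k$ be a positive integer and let $\mu,\lambda$ be integer partitions of $k$, with $\lambda=(\lambda_1,\lambda_2,\dots)$. Then $\mu$ is covered by $\lambda$ in the partial order $\preceq$ (i.e. $\mu\prec\lambda$ and there is no $\nu$ with $\mu\prec\nu\prec\lambda$) if and only if either (1) $\mu$ is obtained from $\lambda$ by merging two parts $\lambda_i$ and $\lambda_j$ ($i\neq j$) that are not both $1$ (i.e. replacing them by $\lambda_i+\lambda_j$ and sorting); or (2) there exist integers $t\geqslant s\geqslant 2$ such that $\lambda_{m-1}\geqslant s$, $\lambda=(\lambda_1,\dots,\lambda_{m-1},s,\underbrace{1,\dots,1}_{t})$ and $\mu=(\lambda_1,\dots,\lambda_{m-1},s,s,\underbrace{1,\dots,1}_{t-s})$.
   Context: A set partition of a finite set is a set of nonempty pairwise disjoint blocks whose union is the set; its type is the integer partition of sorted block sizes. For set partitions of $[k]=\{1,\dots,k\}$, $\pi\vee\tau$ denotes their join in refinement order (finest set partition coarser than both). For integer partitions $\mu,\lambda$ of $k$, $\mu\preceq\lambda$ means there exist $\ell\ge0$ and set partitions $\pi_0,\dots,\pi_\ell$ of $[k]$ of type $\lambda$ with $\pi_0\vee\cdots\vee\pi_\ell$ of type $\mu$; this is a partial order on integer partitions of $k$, and $\mu\prec\lambda$ means $\mu\preceq\lambda$, $\mu\neq\lambda$. *)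

(* Defs.v *)
From HB Require Import structures.
From mathcomp Require Import all_boot.

Set Implicit Arguments.
Unset Strict Implicit.
Unset Printing Implicit Defensive.

(* The part lambda_i (i >= 1) of the mathematical notation is [nth 0 la i.-1]. *)
Definition is_intpart (k : nat) (s : seq nat) : bool :=
  [&& sorted geq s, 0 \notin s & sumn s == k].

Record intpart (k : nat) := IntPart {
  parts :> seq nat;
  partsP : is_intpart k parts
}.

HB.instance Definition _ k := [isSub for @parts k].
HB.instance Definition _ k := [Equality of intpart k by <:].

(* [k] is represented by 'I_k. *)
Record setpart (k : nat) := SetPart {
  blocks :> {set {set 'I_k}};
  blocksP : partition blocks [set: 'I_k]
}.

HB.instance Definition _ k := [isSub for @blocks k].
HB.instance Definition _ k := [Countable of setpart k by <:].
HB.instance Definition _ k := [Finite of setpart k by <:].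

Definition block_sizes (k : nat) (P : setpart k) : seq nat :=
  sort geq [seq #|B : {set 'I_k}| | B <- enum (blocks P)].

Lemma block_sizes_intpart (k : nat) (P : setpart k) :
  is_intpart k (block_sizes P).
Proof.
apply/and3P; split.
- by apply: sort_sorted => m n; exact: leq_total.
- rewrite mem_sort; apply/mapP => -[B]; rewrite mem_enum => PB /esym/eqP.
  rewrite cards_eq0 => /eqP B0.
  by have /and3P[_ _ /negP[]] := blocksP P; rewrite -B0.
- rewrite (perm_sumn (permEl (perm_sort _ _))) sumnE big_map big_enum /=.
  by rewrite -(card_partition (blocksP P)) cardsT card_ord.
Qed.

Definition ptype (k : nat) (P : setpart k) : intpart k :=
  IntPart (block_sizes_intpart P).

Definition finer (k : nat) (P Q : setpart k) : bool :=
  [forall B in blocks P, [exists C in blocks Q, B \subset C]].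

Definition is_join (k : nat) (P Q R : setpart k) : bool :=
  [&& finer P R, finer Q R &
      [forall R', finer P R' && finer Q R' ==> finer R R']].

(* The default value P is never used: see [joinP] and [is_join_uniq]. *)
Definition join (k : nat) (P Q : setpart k) : setpart k :=
  odflt P [pick R | is_join P Q R].

Lemma finerP (k : nat) (P Q : setpart k) :
  reflect (forall x, pblock P x \subset pblock Q x) (finer P Q).
Proof.
have /and3P[/eqP cP tP nP] := blocksP P.
have /and3P[/eqP cQ tQ _] := blocksP Q.
apply: (iffP forall_inP) => [PQ x | PQ B PB].
  have xP : x \in cover P by rewrite cP.
  have /exists_inP[C QC sBC] := PQ _ (pblock_mem xP).
  have xC : x \in C by apply: (subsetP sBC); rewrite mem_pblock.
  by rewrite (def_pblock tQ QC xC).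
have /set0Pn[x xB] : B != set0 by apply: contraNneq nP => <-.
apply/exists_inP; exists (pblock Q x); first by rewrite pblock_mem ?cQ.
by have := PQ x; rewrite (def_pblock tP PB xB).
Qed.

Lemma finer_anti (k : nat) (P Q : setpart k) : finer P Q -> finer Q P -> P = Q.
Proof.
move=> /finerP PQ /finerP QP; apply/val_inj => /=.
rewrite -(equivalence_partition_pblock (blocksP P)).
rewrite -(equivalence_partition_pblock (blocksP Q)).
apply: eq_imset => x; apply/setP => y; rewrite !inE /=.
by apply/idP/idP; [apply: (subsetP (PQ x)) | apply: (subsetP (QP x))].
Qed.

Lemma is_join_exists (k : nat) (P Q : setpart k) : exists R, is_join P Q R.
Proof.
pose e (x y : 'I_k) :=
  [forall R : setpart k, finer P R && finer Q R ==> (y \in pblock R x)].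
have inpb (R : setpart k) x : x \in pblock R x.
  by have /and3P[/eqP cR _ _] := blocksP R; rewrite mem_pblock cR.
have pbE (R : setpart k) x y : (y \in pblock R x) = (pblock R x == pblock R y).
  by have /and3P[/eqP cR tR _] := blocksP R; rewrite eq_pblock ?cR.
have eqe : {in [set: 'I_k] & &, equivalence_rel e}.
  move=> x y z _ _ _; split; first by apply/forallP=> R; rewrite inpb implybT.
  move=> /forallP exy; apply: eq_forallb => R.
  have := exy R; case: (finer P R && finer Q R) => //=.
  by rewrite !pbE => /eqP->.
pose J := SetPart (equivalence_partitionP eqe).
have JE x y : (y \in pblock J x) = e x y.
  by rewrite (pblock_equivalence_partition eqe) ?inE.
exists J; apply/and3P; split.
- apply/finerP=> x; apply/subsetP=> y yx; rewrite JE; apply/forallP=> R.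
  by apply/implyP=> /andP[/finerP PR _]; apply: (subsetP (PR x)).
- apply/finerP=> x; apply/subsetP=> y yx; rewrite JE; apply/forallP=> R.
  by apply/implyP=> /andP[_ /finerP QR]; apply: (subsetP (QR x)).
- apply/forallP=> R; apply/implyP=> PQR; apply/finerP=> x; apply/subsetP=> y.
  by rewrite JE => /forallP/(_ R)/implyP; apply.
Qed.

Lemma is_join_uniq (k : nat) (P Q R R' : setpart k) :
  is_join P Q R -> is_join P Q R' -> R = R'.
Proof.
move=> /and3P[PR QR /forallP minR] /and3P[PR' QR' /forallP minR'].
by apply: finer_anti; [have := minR R' | have := minR' R];
   rewrite ?PR ?QR ?PR' ?QR'.
Qed.

Lemma joinP (k : nat) (P Q : setpart k) : is_join P Q (join P Q).
Proof.
rewrite /join; case: pickP => [R //|noR].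
by have [R] := is_join_exists P Q; rewrite noR.
Qed.

(* The sequence pi_0, ..., pi_l is given as [pi0] followed by [pis], so l is
   the size of [pis]. *)
Definition ppreceq (k : nat) (mu la : intpart k) : Prop :=
  exists (pi0 : setpart k) (pis : seq (setpart k)),
    (forall p, p \in pi0 :: pis -> ptype p = la) /\
    ptype (foldl (@join k) pi0 pis) = mu.

Definition pprec (k : nat) (mu la : intpart k) : Prop :=
  ppreceq mu la /\ mu <> la.

Definition covered_by (k : nat) (mu la : intpart k) : Prop :=
  pprec mu la /\ ~ exists nu : intpart k, pprec mu nu /\ pprec nu la.

Definition merge_parts (la : seq nat) (i j : nat) : seq nat :=
  sort geq ((nth 0 la i + nth 0 la j)
    :: [seq nth 0 la h | h <- iota 0 (size la) & (h != i) && (h != j)]).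

(* Main.v *)
(* mu precedes la (of type not 1^k) exactly when some partition Q of type mu is
   coarser than some P of type la and every part > 1 of mu is at least the
   smallest part > 1 of la. Two kinds of steps are therefore minimal: merging a
   part > 1 with another part, and gluing 1s into a second copy of the smallest
   part s > 1. Any strict step factors through one of these. A merge lowers the
   number of parts by one, so it is a cover. A gluing is a cover because the sum
   of (a - s)^+ over the parts a can only grow along the order; it is unchanged
   by the gluing, but strictly raised by every merge. *)
Require Import Defs.
From mathcomp Require Import all_boot.
From mathcomp Require Import perm zify.

Set Implicit Arguments.
Unset Strict Implicit.
Unset Printing Implicit Defensive.

(** * Equivalence relations and multisets of block sizes *)

(** Refinement is inclusion of these equivalence relations, so most arguments about blocks become
    arguments about pairs of points. *)
Definition same (k : nat) (P : setpart k) (x y : 'I_k) : bool :=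
  y \in pblock P x.

(** Meant up to [perm_eq], and defined for any family so as to apply both to the blocks being glued
    and to the remaining ones. *)
Definition sizes (T : finType) (S : {set {set T}}) : seq nat :=
  [seq #|B : {set T}| | B <- enum S].

Lemma sorted_geq_eq (s1 s2 : seq nat) :
  sorted geq s1 -> sorted geq s2 -> perm_eq s1 s2 -> s1 = s2.
Proof.
apply: sorted_eq => [n m p nm pn | m n /andP[nm mn]].
  exact: leq_trans pn nm.
by apply/eqP; rewrite eqn_leq; apply/andP.
Qed.

Lemma sizesU1 (T : finType) (B : {set T}) (S : {set {set T}}) :
  B \notin S -> perm_eq (sizes (B |: S)) (#|B| :: sizes S).
Proof.
move=> BS; rewrite -[_ :: _]/(map _ (B :: enum S)); apply: perm_map.
apply: uniq_perm; rewrite /= ?enum_uniq ?mem_enum ?BS // => C.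
by rewrite inE !mem_enum in_setU1.
Qed.

Lemma sizesD (T : finType) (S P : {set {set T}}) :
  S \subset P -> perm_eq (sizes P) (sizes S ++ sizes (P :\: S)).
Proof.
move=> /subsetP SP; rewrite -map_cat; apply: perm_map.
apply: uniq_perm; first exact: enum_uniq.
  rewrite cat_uniq !enum_uniq andbT /=; apply/hasPn => B.
  by rewrite !mem_enum inE => /andP[].
move=> B; rewrite mem_cat !mem_enum inE.
by have [/SP|] := boolP (B \in S).
Qed.

Lemma sizes_seq (T : finType) (s : seq {set T}) :
  uniq s -> perm_eq (sizes [set B in s]) [seq #|B : {set T}| | B <- s].
Proof.
move=> us; apply/perm_map/uniq_perm; rewrite ?enum_uniq // => B.
by rewrite mem_enum inE.
Qed.

(** The index permutation matching [map f s] with [l1 ++ l2] rearranges [s]; cutting the result at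
    [size l1] gives [s1] and [s2]. *)
Lemma perm_map_cat (T U : eqType) (x0 : T) (f : T -> U) (s : seq T) l1 l2 :
  perm_eq (map f s) (l1 ++ l2) ->
  exists s1 s2, [/\ perm_eq s (s1 ++ s2), map f s1 = l1 & map f s2 = l2].
Proof.
rewrite perm_sym => /(perm_iotaP (f x0))[Is]; rewrite size_map => pIs l12.
have pIss : perm_eq [seq nth x0 s i | i <- Is] s.
  by rewrite -{2}(mkseq_nth x0 s); apply: perm_map.
have {}l12 : map f [seq nth x0 s i | i <- Is] = l1 ++ l2.
  rewrite l12 -map_comp; apply/eq_in_map => i; rewrite (perm_mem pIs) mem_iota.
  by move=> /andP[_ ilt]; rewrite /= (nth_map x0).
exists (take (size l1) [seq nth x0 s i | i <- Is]),
  (drop (size l1) [seq nth x0 s i | i <- Is]).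
rewrite cat_take_drop perm_sym map_take map_drop l12.
by rewrite take_size_cat ?drop_size_cat.
Qed.

(** Turns a choice of parts into a choice of blocks having those sizes. *)
Lemma sizes_split (T : finType) (P : {set {set T}}) l1 l2 :
  perm_eq (sizes P) (l1 ++ l2) ->
  exists S : {set {set T}},
    [/\ S \subset P, perm_eq (sizes S) l1 & perm_eq (sizes (P :\: S)) l2].
Proof.
move=> /(perm_map_cat set0)[s1 [s2 [Ps <- <-]]].
have us : uniq (s1 ++ s2) by rewrite -(perm_uniq Ps) enum_uniq.
have memP B : (B \in P) = (B \in s1) || (B \in s2).
  by rewrite -mem_cat -(perm_mem Ps) mem_enum.
move: us; rewrite cat_uniq => /and3P[us1 /hasPn s12 us2].
exists [set B in s1]; split; last 2 first.
- exact: sizes_seq.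
- rewrite (_ : P :\: _ = [set B in s2]) ?sizes_seq //; apply/setP => B.
  rewrite !inE memP.
  by have [/s12/negPf->|] := boolP (B \in s2); rewrite ?orbT // orbF andNb.
- by apply/subsetP => B; rewrite inE memP => ->.
Qed.

(** * Moving and choosing subsets *)

(** By induction on the size: each pair [x] in [X], [y] in [Y] is handled by composing with the
    transposition of [x] and [y]. *)
Lemma exists_perm_imset (T : finType) (X Y : {set T}) :
  [disjoint X & Y] -> #|X| = #|Y| ->
  exists2 g : {perm T}, g @: X = Y & forall z, z \notin X :|: Y -> g z = z.
Proof.
move En: #|X| => n; elim: n X Y En => [|n IH] X Y cX dXY cY.
  exists 1%g => [|z _]; last by rewrite perm1.
  by rewrite (cards0_eq cX) (cards0_eq (esym cY)) imset0.
have /card_gt0P[x xX] : 0 < #|X| by rewrite cX.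
have /card_gt0P[y yY] : 0 < #|Y| by rewrite -cY.
have xY : x \notin Y by rewrite (disjointFr dXY).
have yX : y \notin X by rewrite (disjointFl dXY).
have [| | | g gX gE] := IH (X :\ x) (Y :\ y).
- by move: cX; rewrite (cardsD1 x) xX => -[].
- exact: disjointWl (subsetDl _ _) (disjointWr (subsetDl _ _) dXY).
- by move: cY; rewrite (cardsD1 y) yY => -[].
exists (g * tperm x y)%g.
  rewrite -{1}(setD1K xX) -(setD1K yY) imsetU imset_set1 permM gE; last first.
    by rewrite !inE eqxx (negPf xY) andbF.
  rewrite tpermL; congr (_ |: _); rewrite -gX.
  apply: eq_in_imset => z zX; rewrite permM tpermD //.
    have : g z \in Y :\ y by rewrite -gX; exact: imset_f.
    by apply: contraTneq => <-; rewrite !inE (negPf xY) andbF.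
  have : g z \in Y :\ y by rewrite -gX; exact: imset_f.
  by apply: contraTneq => <-; rewrite !inE eqxx.
move=> z; rewrite inE negb_or => /andP[zX zY].
rewrite permM gE; last by rewrite !inE (negPf zX) (negPf zY) !andbF.
by rewrite tpermD //; [apply: contraNneq zX => <- | apply: contraNneq zY => <-].
Qed.

Lemma exists_subset_between (T : finType) (A D : {set T}) n :
  A \subset D -> #|A| <= n <= #|D| ->
  exists Y : {set T}, [/\ A \subset Y, Y \subset D & #|Y| = n].
Proof.
move=> AD /andP[An nD].
have /card_gt0P[B] : 0 < #|[set B : {set T} | B \subset D :\: A & #|B| == n - #|A|]|.
  by rewrite cards_draws bin_gt0 cardsDS // leq_sub2r.
rewrite inE subsetD => /andP[/andP[BD BA] /eqP cB].
exists (A :|: B); rewrite subsetUl subUset AD BD; split=> //.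
by rewrite cardsU disjoint_setI0 1?disjoint_sym // cards0 subn0 cB subnKC.
Qed.

(** * Lists ending in ones *)

Lemma sorted_split (r : seq nat) s t m :
  0 < s -> sorted geq (r ++ s :: nseq t 1) -> sorted geq (r ++ s :: s :: nseq m 1).
Proof.
move=> s0; have ps n : path geq s (nseq n 1).
  by case: n => //= n; rewrite s0; elim: n => //= n ->.
by case: r => [|a r] /=; rewrite ?leqnn ?ps // !cat_path /= leqnn !ps !andbT.
Qed.

(** The number of trailing ones is intrinsic: it is the position of the first entry above 1 in the
    reversed list. Hence a partition admits at most one split. *)
Lemma split_inj (r r' : seq nat) s s' t t' : 2 <= s -> 2 <= s' ->
  r ++ s :: nseq t 1 = r' ++ s' :: nseq t' 1 -> [/\ r = r', s = s' & t = t'].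
Proof.
move=> s2 s'2 E.
have lead1 (q : seq nat) u n : 2 <= u -> find (leq 2) (rev (q ++ u :: nseq n 1)) = n.
  move=> u2; rewrite rev_cat rev_cons rev_nseq -cats1 -catA find_cat has_nseq andbF.
  by rewrite /= u2 size_nseq addn0.
have tt' : t = t' by rewrite -(lead1 r s t s2) E lead1.
have rr' : size r = size r'.
  by have := congr1 size E; rewrite tt' !size_cat /= !size_nseq; lia.
by move: E => /eqP; rewrite tt' eqseq_cat // => /andP[/eqP-> /eqP[->]].
Qed.

(** * Blocks and refinement of set partitions *)

Section SetPartitions.

Variable k : nat.
Implicit Types (P Q R : setpart k) (B C D X Y : {set 'I_k}).
Implicit Types (la mu nu : intpart k).

Lemma setpart_cover P x : x \in cover P.
Proof. by rewrite (cover_partition (blocksP P)). Qed.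

Lemma setpart_triv P : trivIset P.
Proof. exact: partition_trivIset (blocksP P). Qed.

Lemma pblock_in P x : pblock P x \in blocks P.
Proof. exact/pblock_mem/setpart_cover. Qed.

Lemma pblock_def P B x : B \in blocks P -> x \in B -> pblock P x = B.
Proof. exact/def_pblock/setpart_triv. Qed.

Lemma block_pblock P B :
  B \in blocks P -> exists2 x, x \in B & B = pblock P x.
Proof.
move=> PB; have /set0Pn[x xB] := partition_neq0 (blocksP P) PB.
by exists x => //; rewrite (pblock_def PB xB).
Qed.

Lemma sameE P x y : same P x y = (pblock P x == pblock P y).
Proof. by rewrite eq_pblock ?setpart_cover ?setpart_triv. Qed.

Lemma same_refl P x : same P x x.
Proof. by rewrite sameE. Qed.

Lemma same_sym P x y : same P x y = same P y x.
Proof. by rewrite !sameE eq_sym. Qed.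

Lemma same_trans P y x z : same P x y -> same P y z -> same P x z.
Proof. by rewrite !sameE => /eqP->. Qed.

Lemma sameP P x y :
  reflect (exists2 B, B \in blocks P & x \in B /\ y \in B) (same P x y).
Proof.
apply: (iffP idP) => [xy | [B PB [xB yB]]].
  by exists (pblock P x); [exact: pblock_in | split=> //; exact: same_refl].
by rewrite /same (pblock_def PB xB).
Qed.

Lemma finer_sameP P Q :
  reflect (forall x y, same P x y -> same Q x y) (finer P Q).
Proof.
apply: (iffP (finerP P Q)) => [PQ x y | PQ x].
  exact: (subsetP (PQ x)).
by apply/subsetP=> y; exact: PQ.
Qed.

Lemma finer_refl P : finer P P.
Proof. exact/finer_sameP. Qed.

Lemma finer_trans P Q R : finer P Q -> finer Q R -> finer P R.
Proof.
move=> /finer_sameP PQ /finer_sameP QR.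
by apply/finer_sameP=> x y /PQ /QR.
Qed.

Lemma finer_blocksP P Q :
  (forall B, B \in blocks P -> exists2 C, C \in blocks Q & B \subset C) ->
  finer P Q.
Proof.
by move=> PQ; apply/forall_inP=> B /PQ[C QC BC]; apply/exists_inP; exists C.
Qed.

Lemma perm_sizes P : perm_eq (parts (ptype P)) (sizes (blocks P)).
Proof. by rewrite /= /block_sizes perm_sort. Qed.

Lemma mem_ptype P a :
  reflect (exists2 B, B \in blocks P & #|B| = a) (a \in parts (ptype P)).
Proof.
rewrite (perm_mem (perm_sizes P)).
apply: (iffP mapP) => [[B] | [B PB <-]]; last by exists B; rewrite ?mem_enum.
by rewrite mem_enum => PB ->; exists B.
Qed.

Lemma intpart_eq (la mu : intpart k) : perm_eq (parts la) (parts mu) -> la = mu.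
Proof.
move=> lamu; apply/val_inj.
have [/and3P[sla _ _] /and3P[smu _ _]] := (partsP la, partsP mu).
exact: sorted_geq_eq.
Qed.

Lemma ptype_eq P (la : intpart k) :
  perm_eq (sizes (blocks P)) (parts la) -> ptype P = la.
Proof. by move=> Pla; apply/intpart_eq/(perm_trans (perm_sizes P)). Qed.

(** * Images under permutations of the ground set *)

Section Permute.

Variables (g : {perm 'I_k}) (P : setpart k).

Lemma permute_partition :
  partition [set g @: B | B : {set _} in blocks P] [set: 'I_k].
Proof.
apply/and3P; split.
- rewrite eqEsubset subsetT; apply/subsetP=> x _; apply/bigcupP.
  exists (g @: pblock P (g^-1%g x)); first exact/imset_f/pblock_in.
  by apply/imsetP; exists (g^-1%g x); [exact: same_refl | rewrite permKV].
- apply/trivIsetP=> _ _ /imsetP[B PB ->] /imsetP[C PC ->] BC.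
  rewrite imset_disjoint //; last exact: perm_inj.
  by apply: (trivIsetP (setpart_triv P)) => //; apply: contraNneq BC => ->.
- apply/imsetP=> -[B PB] /esym/eqP; rewrite imset_eq0 => /eqP B0.
  by have := partition_neq0 (blocksP P) PB; rewrite B0 eqxx.
Qed.

Definition permute : setpart k := SetPart permute_partition.

Lemma ptype_permute : ptype permute = ptype P.
Proof.
apply: ptype_eq; rewrite (permPr (perm_sizes P)) /sizes.
have: perm_eq (enum [set g @: B | B : {set _} in blocks P])
              [seq g @: (B : {set _}) | B <- enum (blocks P)].
  apply: uniq_perm; rewrite ?enum_uniq ?map_inj_uniq ?enum_uniq //.
    exact/imset_inj/perm_inj.
  move=> B; rewrite mem_enum; apply/imsetP/mapP => -[C PC ->]; exists C => //.
    by rewrite mem_enum.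
  by rewrite mem_enum in PC.
move=> /(perm_map (fun B : {set _} => #|B|))/permPl->; rewrite -map_comp.
rewrite (@eq_map _ _ _ (fun B : {set _} => #|B|)) ?perm_refl // => B /=.
by rewrite card_imset //; exact: perm_inj.
Qed.

Lemma same_permute x y : same P x y -> same permute (g x) (g y).
Proof.
move=> /sameP[B PB [xB yB]]; apply/sameP; exists (g @: B); first exact: imset_f.
by split; apply: imset_f.
Qed.

Lemma permute_finer Q :
  (forall x y, same P x y -> same Q (g x) (g y)) -> finer permute Q.
Proof.
move=> PQ; apply/finer_sameP=> u v /sameP[_ /imsetP[B PB ->]].
move=> [/imsetP[x xB ->] /imsetP[y yB ->]].
by apply: PQ; apply/sameP; exists B.
Qed.

End Permute.

(** * Gluing blocks, and existence of each type *)

(** [cover S] is the union of the glued blocks; it is nonempty because [S] is. *)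
Lemma merge_partition P (S : {set {set 'I_k}}) :
  S \subset blocks P -> S != set0 ->
  partition (cover S |: (blocks P :\: S)) [set: 'I_k].
Proof.
move=> SP /set0Pn[B0 SB0]; apply/and3P; split.
- rewrite eqEsubset subsetT; apply/subsetP=> x _; apply/bigcupP.
  have [xS | xS] := boolP (pblock P x \in S).
    exists (cover S); first exact: setU11.
    by apply/bigcupP; exists (pblock P x) => //; exact: same_refl.
  exists (pblock P x); last exact: same_refl.
  by rewrite !inE xS pblock_in orbT.
- have disj C : C \in blocks P :\: S -> [disjoint cover S & C].
    rewrite inE => /andP[CS PC]; rewrite disjoint_sym; apply/bigcup_disjointP => B SB.
    apply: (trivIsetP (setpart_triv P)) => //; first exact: (subsetP SP).
    by apply: contraNneq CS => ->.
  apply/trivIsetP=> C D /setU1P[->|PC] /setU1P[->|PD]; rewrite ?eqxx //.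
  + by move=> _; exact: disj.
  + by move=> _; rewrite disjoint_sym; exact: disj.
  + by apply: (trivIsetP (trivIsetD S (setpart_triv P))).
- rewrite !inE negb_or !negb_and negbK; apply/andP; split.
    have /set0Pn[x xB] := partition_neq0 (blocksP P) (subsetP SP _ SB0).
    apply: contraTneq xB => S0; have: x \notin cover S by rewrite -S0 inE.
    by apply: contra => xB; apply/bigcupP; exists B0.
  by rewrite (partition0 (blocksP P)) orbT.
Qed.

Lemma sumn_sizes P (S : {set {set 'I_k}}) :
  S \subset blocks P -> sumn (sizes S) = #|cover S|.
Proof.
move=> SP; have /eqP <- := trivIsetS SP (setpart_triv P).
by rewrite sumnE big_map big_enum.
Qed.

Lemma merge_exists P (S : {set {set 'I_k}}) :
  S \subset blocks P -> S != set0 ->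
  exists R : setpart k,
    [/\ blocks R = cover S |: (blocks P :\: S), finer P R &
        perm_eq (sizes (blocks R)) (sumn (sizes S) :: sizes (blocks P :\: S))].
Proof.
move=> SP S0; exists (SetPart (merge_partition SP S0)); split => //=.
  apply: finer_blocksP => B PB /=; have [SB | SB] := boolP (B \in S).
    by exists (cover S); rewrite ?setU11 //; exact: bigcup_sup.
  by exists B; rewrite // !inE SB PB orbT.
rewrite (sumn_sizes SP); apply: sizesU1; rewrite inE negb_and negbK.
(* [cover S] is no block of [P] outside [S]: it meets a block [B] of [S], so it would equal [B]. *)
have [//|SS /=] := boolP (cover S \in S).
have /set0Pn[B SB] := S0; have PB := subsetP SP _ SB.
apply: contraNN SS => PS; have [x xB _] := block_pblock PB.
rewrite -(pblock_def PS (x := x)) ?(pblock_def PB) //.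
by apply/bigcupP; exists B.
Qed.

Lemma merge_finer P Q R (S : {set {set 'I_k}}) D :
  blocks R = cover S |: (blocks P :\: S) ->
  finer P Q -> D \in blocks Q -> cover S \subset D -> finer R Q.
Proof.
move=> RE PQ QD SD; apply: finer_blocksP => B.
rewrite RE => /setU1P[->|]; first by exists D.
rewrite inE => /andP[_ PB].
by have /exists_inP[C] := forall_inP PQ _ PB; exists C.
Qed.

(** Cut off a set of the first size and recurse on the rest, which is why [H] is stated for an
    arbitrary subset [A]. *)
Lemma setpart_exists (la : intpart k) : exists P : setpart k, ptype P = la.
Proof.
have H (A : {set 'I_k}) (l : seq nat) : 0 \notin l -> sumn l = #|A| ->
    exists2 P, partition P A & perm_eq (sizes P) l.
  elim: l A => [|a l IH] A /= l0 sl.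
    exists set0; last by rewrite /sizes enum_set0.
    by rewrite (cards0_eq (esym sl)) partition_set0.
  have [B BA cB] : exists2 B : {set 'I_k}, B \subset A & #|B| = a.
    have /card_gt0P[B] : 0 < #|[set B : {set 'I_k} | B \subset A & #|B| == a]|.
      by rewrite cards_draws bin_gt0 -sl leq_addr.
    by rewrite inE => /andP[BA /eqP cB]; exists B.
  have [||P pP sP] := IH (A :\: B).
  - by move: l0; rewrite inE negb_or => /andP[].
  - by rewrite cardsDS // cB -sl addKn.
  have B0 : B != set0.
    by rewrite -card_gt0 cB lt0n; apply: contraNneq l0 => ->; rewrite inE eqxx.
  have BD : [disjoint B & A :\: B] by rewrite disjoints_subset setCD subsetUr.
  exists (B |: P).
    have -> : A = B :|: A :\: B by rewrite -{1}(setID A B) (setIidPr BA).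
    exact: partitionU1.
  have BP : B \notin P.
    apply/negP => /(partitionS pP) BAB.
    by case/negP: B0; rewrite -(setIidPl BAB) setI_eq0.
  by rewrite (permPl (sizesU1 BP)) cB perm_cons.
have [l0 sl] : 0 \notin parts la /\ sumn la = #|[set: 'I_k]|.
  by have /and3P[_ -> /eqP->] := partsP la; rewrite cardsT card_ord.
have [P pP sP] := H _ _ l0 sl.
by exists (SetPart pP); apply: ptype_eq.
Qed.

(** * Iterated joins *)

(** With [foldl_join_least], this makes the iterated join a least upper bound, which is all that is
    used about joins below. *)
Lemma foldl_join_ub P (s : seq (setpart k)) Q :
  Q \in P :: s -> finer Q (foldl (@join k) P s).
Proof.
elim: s P Q => [|R s IH] P Q /=; first by rewrite inE => /eqP->; exact: finer_refl.
have /and3P[PJ RJ _] := joinP P R.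
have Js : finer (join P R) (foldl (@join k) (join P R) s).
  by apply: IH; exact: mem_head.
rewrite !inE => /or3P[/eqP->|/eqP->|Qs]; try exact: finer_trans Js.
by apply: IH; rewrite inE Qs orbT.
Qed.

Lemma foldl_join_least P (s : seq (setpart k)) R :
  (forall Q, Q \in P :: s -> finer Q R) -> finer (foldl (@join k) P s) R.
Proof.
elim: s P => [|Q s IH] P PsR /=; first exact/PsR/mem_head.
apply: IH => U; rewrite inE => /orP[/eqP->|Us]; last first.
  by apply: PsR; rewrite !inE Us !orbT.
have /and3P[_ _ /forallP/(_ R)/implyP] := joinP P Q; apply.
by rewrite !PsR ?inE ?eqxx ?orbT.
Qed.

(** * Characterization of the order by a single pair of set partitions *)

Lemma setpart_of_rel (e : rel 'I_k) :
  equivalence_rel e -> exists R, forall x y, same R x y = e x y.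
Proof.
move=> eqe; have eqT : {in [set: 'I_k] & &, equivalence_rel e}.
  by move=> x y z _ _ _; exact: eqe.
exists (SetPart (equivalence_partitionP eqT)) => x y.
by rewrite /same (pblock_equivalence_partition eqT) ?inE.
Qed.

Lemma pblock_singleton P x y : #|pblock P x| < 2 -> same P x y -> x = y.
Proof.
rewrite ltnS => /card_le1_eqP P1 xy.
by apply: P1; rewrite // -/(same P x x) same_refl.
Qed.

(** If no part of [la] lay between 2 and the size of [D], every joined partition would cut [D] into
    singletons. Breaking [D] into singletons in [Q] would still give an upper bound, so leastness of
    the join leaves [D] with at most one point. *)
Lemma ppreceqW (mu la : intpart k) : ppreceq mu la ->
  exists P Q, [/\ ptype P = la, ptype Q = mu, finer P Q &
    forall D, D \in blocks Q -> 2 <= #|D| ->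
      exists2 a, a \in parts la & 2 <= a <= #|D| ].
Proof.
move=> [P [s [Ps sQ]]]; set Q := foldl _ _ _ in sQ.
exists P, Q; split => //; first by rewrite Ps ?mem_head.
  by apply: foldl_join_ub; exact: mem_head.
move=> D QD D2; apply/hasP; apply: contraTT D2 => /hasPn smallD.
(* The relation of [Q] with [D] broken into singletons. *)
pose e x y := (x == y) || same Q x y && (x \notin D).
have memD x y : same Q x y -> (x \in D) = (y \in D).
  move=> xy; apply/idP/idP => [xD | yD]; first by rewrite -(pblock_def QD xD).
  by rewrite -(pblock_def QD yD) -/(same Q y x) same_sym.
have [x y z | R RE] := @setpart_of_rel e.
  rewrite /e eqxx; split=> // /orP[/eqP-> //|/andP[xy xD]].
  have eqS a : (a == z) || same Q a z = same Q a z.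
    by case: eqVneq => // ->; rewrite same_refl.
  rewrite -(memD _ _ xy) xD !andbT !eqS !sameE.
  by move: xy; rewrite sameE => /eqP->.
have QR : finer Q R.
  apply: foldl_join_least => U Us; apply/finer_sameP => x y xyU; rewrite RE /e.
  have UQ : finer U Q := foldl_join_ub Us.
  have -> : same Q x y by apply: (finer_sameP _ _ UQ).
  case: (boolP (x \in D)) => [xD | _]; last by rewrite orbT.
  rewrite orbF; apply/eqP; apply: pblock_singleton xyU.
  rewrite ltnNge; apply: contraT; rewrite negbK => U2.
  have /smallD : #|pblock U x| \in parts la.
    by rewrite -(Ps _ Us); apply/mem_ptype; exists (pblock U x); rewrite ?pblock_in.
  rewrite U2 /= => /negP[]; rewrite -(pblock_def QD xD).
  by apply/subset_leq_card/(finerP _ _ UQ).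
rewrite -ltnNge ltnS; apply/card_le1_eqP => x y xD yD.
have /(finer_sameP _ _ QR) : same Q x y by apply/sameP; exists D.
by rewrite RE /e xD andbF orbF => /eqP.
Qed.

(* The join of all partitions of the type of P lying below Q is Q itself: a
   block D of Q containing a nontrivial block of P is connected by transposing
   elements of D, and a block D cut into singletons by P is connected by moving
   a nontrivial block of P into D. *)
Lemma ppreceqI P Q :
  finer P Q ->
  (forall D, D \in blocks Q -> 2 <= #|D| ->
     exists2 X, X \in blocks P & 2 <= #|X| <= #|D|) ->
  ppreceq (ptype Q) (ptype P).
Proof.
move=> PQ bigD; exists P.
exists [seq U <- enum {: setpart k} | (ptype U == ptype P) && finer U Q].
split=> [U|].
  by rewrite inE mem_filter => /orP[/eqP->|/andP[/andP[/eqP]]].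
congr ptype; set s := [seq _ <- _ | _]; set J := foldl _ _ _.
have belowJ U : ptype U = ptype P -> finer U Q -> finer U J.
  move=> tU UQ; apply: foldl_join_ub; rewrite inE mem_filter tU eqxx UQ /=.
  by rewrite mem_enum orbT.
apply: finer_anti.
  apply: foldl_join_least => U; rewrite inE mem_filter => /orP[/eqP-> //|].
  by move=> /andP[/andP[_]].
have sPQ x y : same P x y -> same Q x y by apply: (finer_sameP _ _ PQ).
(* A permutation sending blocks of [P] into blocks of [Q] yields one of the joined partitions. *)
have permJ (g : {perm 'I_k}) x y : (forall u v, same P u v -> same Q (g u) (g v)) ->
    same P x y -> same J (g x) (g y).
  move=> gQ xy; have UJ := belowJ _ (ptype_permute g P) (permute_finer gQ).
  exact: (finer_sameP _ _ UJ) (same_permute g xy).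
have PJ : forall x y, same P x y -> same J x y.
  by apply/finer_sameP; exact: belowJ.
apply/finer_sameP=> x y xy; have [<-|xNy] := eqVneq x y; first exact: same_refl.
set D := pblock Q x; have QD : D \in blocks Q := pblock_in Q x.
have xD : x \in D := same_refl Q x.
have yD : y \in D := xy.
have sameD u v : u \in D -> v \in D -> same Q u v by move=> *; apply/sameP; exists D.
have [/existsP[x0 /andP[x0D x0P]] | /existsPn triv] :=
  boolP [exists x0, (x0 \in D) && (1 < #|pblock P x0|)].
  suff toJ z : z \in D -> same J x0 z.
    by apply: (same_trans (y := x0)); [rewrite same_sym |]; exact: toJ.
  move=> zD; have [/PJ // | x0z] := boolP (same P x0 z).
  have /card_gt1P[u [v [ux0 vx0 uv]]] := x0P.
  have [x1 x1P x1x0] : exists2 x1, same P x0 x1 & x1 != x0.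
    by have [ux|?] := eqVneq u x0; [exists v => //; rewrite -ux eq_sym | exists u].
  have x1D : x1 \in D by rewrite -(pblock_def QD x0D); exact: sPQ.
  (* The transposition fixes [x0] and sends its companion [x1] to [z]. *)
  have := @permJ (tperm x1 z) x0 x1 _ x1P.
  rewrite tpermL tpermD //; last by apply: contraNneq x0z => ->; exact: same_refl.
  apply=> a b /sPQ ab.
  have tQ c : same Q c (tperm x1 z c).
    by case: tpermP => [->|->|_ _]; rewrite ?same_refl ?sameD.
  apply: same_trans (tQ b); apply: same_trans ab.
  by rewrite same_sym.
have trivP u v : u \in D -> same P u v -> u = v.
  move=> uD; apply: pblock_singleton.
  by have := triv u; rewrite uD -leqNgt.
have [|X PX /andP[X2 XD]] := bigD D QD; first by apply/card_gt1P; exists x, y; split.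
have dXD z : z \in X -> z \notin D.
  move=> zX; apply/negP => /trivP Pz; move: X2; rewrite ltnNge => /negP; apply.
  apply/card_le1_eqP => a b; rewrite -(pblock_def PX zX) => az bz.
  by rewrite -(Pz a az) -(Pz b bz).
(* [Y] is the target for [X]: it has the same size and contains both [x] and [y]. *)
have [||Y [xyY YD cY]] := @exists_subset_between _ [set x; y] D #|X|.
- by rewrite subUset !sub1set xD.
- by rewrite cards2 xNy X2.
have [||g gX gE] := @exists_perm_imset _ X Y; rewrite ?cY //.
  rewrite disjoint_subset; apply/subsetP=> z zX; rewrite inE.
  by apply: contra (dXD z zX); exact: (subsetP YD).
have [xY yY] : x \in Y /\ y \in Y by split; apply: (subsetP xyY); rewrite !inE eqxx ?orbT.
move: xY yY; rewrite -gX => /imsetP[a aX ->] /imsetP[b bX ->].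
apply: permJ; last by apply/sameP; exists X.
have gD c : c \in X -> g c \in D by move=> cX; apply: (subsetP YD); rewrite -gX imset_f.
have XP c d : c \in X -> same P c d -> d \in X.
  by move=> cX; rewrite /same (pblock_def PX cX).
(* Points of [X] land in [D], points of [Y] are singletons of [P], and all others are fixed. *)
move=> u v uv; have [uX | uX] := boolP (u \in X).
  by apply: sameD; apply: gD => //; exact: XP uv.
have vX : v \notin X by apply: contra uX => /XP; apply; rewrite same_sym.
have [uY | uY] := boolP (u \in Y).
  by rewrite (trivP u v) ?same_refl //; exact: (subsetP YD).
have vY : v \notin Y.
  apply: contra uY => vY; rewrite -(trivP v u) // 1?same_sym //.
  exact: (subsetP YD).
by rewrite !gE ?inE ?negb_or ?uX ?uY ?vX ?vY //; exact: sPQ.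
Qed.

(** * Quantities monotone under refinement *)

(** For a block [B] of a partition finer than [Q], the block of [Q] containing [B], written without
    choosing a point of [B]. *)
Definition coarse_block Q B : {set 'I_k} := \bigcup_(x in B) pblock Q x.

Lemma coarse_blockE P Q x :
  finer P Q -> coarse_block Q (pblock P x) = pblock Q x.
Proof.
move=> /finer_sameP PQ; apply/eqP; rewrite eqEsubset; apply/andP; split.
  apply/bigcupsP => y /PQ xy; have := xy; rewrite -/(same Q x y) sameE.
  by move=> /eqP->.
exact: (bigcup_sup x (same_refl P x)).
Qed.

Lemma blocks_coarse P Q :
  finer P Q -> blocks Q = coarse_block Q @: blocks P.
Proof.
move=> PQ; apply/setP => D; apply/idP/imsetP => [/block_pblock[x _ ->] | [B]].
  by exists (pblock P x); rewrite ?pblock_in ?coarse_blockE.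
by move=> /block_pblock[x _ ->] ->; rewrite coarse_blockE ?pblock_in.
Qed.

(** [coarse_block Q] maps the blocks of [P] onto those of [Q]; were it injective, points together in
    [Q] would be together in [P]. *)
Lemma finer_card P Q : finer P Q -> P <> Q -> #|blocks Q| < #|blocks P|.
Proof.
move=> PQ PNQ; rewrite ltn_neqAle (blocks_coarse PQ) leq_imset_card andbT.
apply/imset_injP => inj; apply: PNQ; apply: finer_anti => //.
apply/finer_sameP => x y; rewrite !sameE -!(coarse_blockE _ PQ) => /eqP xy.
by apply/eqP/inj; rewrite ?pblock_in.
Qed.

(** Inside each block [D] of [Q] this is superadditivity of truncated subtraction of [s], applied to
    the blocks of [P] that make up [D]. *)
Lemma sum_subn_finer s P Q : finer P Q ->
  \sum_(B in blocks P) (#|B| - s) <= \sum_(D in blocks Q) (#|D| - s).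
Proof.
move=> PQ; rewrite (partition_big (coarse_block Q) (mem (blocks Q))) /=; last first.
  by move=> B PB; rewrite (blocks_coarse PQ) imset_f.
apply: leq_sum => D QD.
have -> : #|D| = \sum_(B in blocks P | coarse_block Q B == D) #|B|.
  rewrite -sum1_card (partition_big (pblock P)
    (fun B => (B \in blocks P) && (coarse_block Q B == D))).
    apply: eq_bigr => B /andP[PB /eqP BD]; rewrite -sum1_card.
    apply: eq_bigl => x; apply/andP/idP => [[_ /eqP<-]|xB]; first exact: same_refl.
    rewrite (pblock_def PB xB) eqxx; split=> //.
    rewrite -BD -(pblock_def PB xB) coarse_blockE //; exact: same_refl.
  by move=> x xD; rewrite pblock_in coarse_blockE // (pblock_def QD xD) eqxx.
apply: (big_rec2 (fun a b => a <= b - s)) => // B a b _; move: #|_| => n. lia.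
Qed.

Lemma size_ptype P : size (parts (ptype P)) = #|blocks P|.
Proof. by rewrite (perm_size (perm_sizes P)) size_map cardE. Qed.

Lemma sum_ptype P (f : nat -> nat) :
  \sum_(a <- parts (ptype P)) f a = \sum_(B in blocks P) f #|B|.
Proof. by rewrite (perm_big _ (perm_sizes P)) big_map big_enum. Qed.

Lemma pprec_size mu la : pprec mu la -> size mu < size la.
Proof.
move=> [/ppreceqW[P [Q [<- <- PQ _]]] QNP].
by rewrite !size_ptype; apply: finer_card => // PQE; apply: QNP; rewrite PQE.
Qed.

Lemma ppreceq_size mu la : ppreceq mu la -> mu = la \/ size mu < size la.
Proof.
by move=> mula; have [|/eqP] := eqVneq mu la; [left | right; exact: pprec_size].
Qed.

Lemma ppreceq_sum_subn s mu la : ppreceq mu la ->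
  \sum_(a <- parts la) (a - s) <= \sum_(a <- parts mu) (a - s).
Proof.
move=> /ppreceqW[P [Q [<- <- PQ _]]].
by rewrite (sum_ptype P (subn^~ s)) (sum_ptype Q (subn^~ s)); exact: sum_subn_finer.
Qed.

(** * Merges and splits are strict steps *)

Lemma parts_gt0 la a : a \in parts la -> 0 < a.
Proof.
have /and3P[_ l0 _] := partsP la.
by rewrite lt0n; apply: contraTneq => ->.
Qed.

(** The merged parts are named so that [a] is one exceeding 1; [b] may be 1. *)
Definition is_merge mu la : Prop :=
  exists a b l, [/\ 2 <= a, perm_eq (parts la) (a :: b :: l) &
                    perm_eq (parts mu) (a + b :: l)].

(** Gluing [s] of the [t] ones creates the second copy of [s]. *)
Definition is_split mu la : Prop :=
  exists t s r, [/\ 2 <= s <= t, parts la = r ++ s :: nseq t 1 &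
                    parts mu = r ++ s :: s :: nseq (t - s) 1].

(** Common to both kinds of step: blocks of sizes [l1] are glued, the last hypothesis provides the
    small nontrivial blocks for [ppreceqI], and the lengths show that [mu] differs from [la]. *)
Lemma sum_parts_pprec mu la (l1 l2 : seq nat) :
  perm_eq (parts la) (l1 ++ l2) -> perm_eq (parts mu) (sumn l1 :: l2) ->
  1 < size l1 ->
  (forall b : nat, b \in parts mu -> 2 <= b ->
     exists2 a, a \in parts la & 2 <= a <= b) ->
  pprec mu la.
Proof.
move=> Ela Emu l1_2 big; split; last first.
  move=> mula; have := perm_size Emu; rewrite mula (perm_size Ela) size_cat /=. lia.
have [P Pla] := setpart_exists la.
have := Ela; rewrite -Pla (permPl (perm_sizes P)) => /sizes_split[S [SP Sl1 Sl2]].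
have S0 : S != set0.
  by apply: contraTneq l1_2 => S0; rewrite -(perm_size Sl1) S0 /sizes enum_set0.
have [R [_ PR Rs]] := merge_exists SP S0.
have <- : ptype R = mu.
  apply: ptype_eq; rewrite (permPl Rs) (perm_sumn Sl1) (permPr Emu).
  by rewrite perm_cons.
apply: ppreceqI => // D RD D2; have [] := big #|D| _ D2.
  rewrite (perm_mem Emu) -(perm_sumn Sl1).
  rewrite (perm_mem (_ : perm_eq _ (sizes (blocks R)))); first by rewrite map_f ?mem_enum.
  by rewrite perm_sym (permPl Rs) perm_cons.
by move=> a; rewrite -Pla => /mem_ptype[B PB <-] ?; exists B.
Qed.

Lemma is_merge_pprec mu la : is_merge mu la -> pprec mu la.
Proof.
move=> [a [b [l [a2 Ela Emu]]]].
apply: (@sum_parts_pprec _ _ [:: a; b] l); rewrite //= ?addn0 //.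
move=> c; rewrite (perm_mem Emu) inE => /orP[/eqP-> _|cl c2].
  by exists a; rewrite ?(perm_mem Ela) ?mem_head // a2 leq_addr.
by exists c; rewrite ?c2 ?leqnn // (perm_mem Ela) !inE cl !orbT.
Qed.

Lemma is_split_pprec mu la : is_split mu la -> pprec mu la.
Proof.
move=> [t [s [r [/andP[s2 st] Ela Emu]]]].
apply: (@sum_parts_pprec _ _ (nseq s 1) (r ++ s :: nseq (t - s) 1)).
- by rewrite Ela -{1}(subnKC st) nseqD -cat_rcons perm_catCA cat_rcons.
- by rewrite Emu sumn_nseq mul1n -cat1s perm_catCA.
- by rewrite size_nseq.
move=> c; rewrite Emu => cmu c2; exists c; rewrite ?c2 ?leqnn // Ela.
move: cmu; rewrite !mem_cat !inE => /or4P[->|->|->|]; rewrite ?orbT //.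
by rewrite mem_nseq => /andP[_ /eqP c1]; rewrite c1 in c2.
Qed.

(** * Factoring strict steps *)

Lemma parts_geq la r s l :
  parts la = r ++ s :: l -> forall a, a \in r -> s <= a.
Proof.
move=> E a ar; have /and3P[+ _ _] := partsP la.
rewrite E sorted_pairwise; last by move=> n m p nm pn; exact: leq_trans pn nm.
by rewrite pairwise_cat => /andP[/allrelP/(_ a s ar (mem_head _ _))].
Qed.

(** Cut at the last entry above 1: what follows is nonzero, hence all ones, and sortedness makes [s]
    the least part above 1. *)
Lemma parts_smallest la : has (leq 2) (parts la) ->
  exists r s t, [/\ 2 <= s, parts la = r ++ s :: nseq t 1 &
                    forall a, a \in r -> s <= a].
Proof.
move=> big; have /and3P[_ l0 _] := partsP la.
have [r [s [t [s2 E]]]] : exists r s t, 2 <= s /\ parts la = r ++ s :: nseq t 1.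
  elim: (parts la) l0 big => //= a l IH.
  rewrite inE negb_or eq_sym => /andP[a0 l0] a2.
  have [/(IH l0)[r [s [t [s2 ->]]]]|/hasPn l1] := boolP (has (leq 2) l).
    by exists (a :: r), s, t.
  exists [::], a, (size l); split; first by case/orP: a2 => // /hasP[b /l1/negP nb /nb].
  congr (_ :: _); apply/all_pred1P/allP => b bl.
  have b0 : b != 0 by apply: contraNneq l0 => b0; rewrite -b0.
  by move: (l1 _ bl) b0 => /=; case: b {bl} => [|[|b]].
by exists r, s, t; split=> // a; exact: parts_geq E _.
Qed.

(* Take P finer than Q, of types la and nu. If a nontrivial block D of Q is a
   union of singletons of P, gluing s of them, with s the least part > 1 of la,
   gives a split; otherwise every nontrivial block of Q contains a nontrivial
   block of P, so any merge of two blocks of P inside a block of Q will do. *)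
Lemma pprec_through_cover nu la :
  pprec nu la ->
  exists2 c : intpart k, is_merge c la \/ is_split c la & ppreceq nu c.
Proof.
move=> [/ppreceqW[P [Q [Pla <- PQ big]]] QNla].
have PNQ : ~~ finer Q P.
  by apply/negP => QP; apply: QNla; rewrite (finer_anti QP PQ).
have sPQ x y : same P x y -> same Q x y by apply: (finer_sameP _ _ PQ).
have [/exists_inP[D QD /andP[D2 /forall_inP Dtriv]] | /exists_inPn nontriv] :=
  boolP [exists D in blocks Q, (1 < #|D|) && [forall x in D, #|pblock P x| < 2]].
  have [a ala /andP[a2 aD]] := big _ QD D2.
  have [|r [s [t [s2 Ela rs]]]] := @parts_smallest la; first by apply/hasP; exists a.
  have sa : s <= a.
    move: ala; rewrite Ela mem_cat inE mem_nseq => /or3P[/rs|/eqP->|/andP[_ /eqP a1]] //.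
    by rewrite a1 in a2.
  have [||Y [_ YD Ys]] := @exists_subset_between _ set0 D s; rewrite ?sub0set //.
    by rewrite cards0 (leq_trans sa).
  pose S := [set [set x] | x in Y].
  have SP : S \subset blocks P.
    apply/subsetP => _ /imsetP[x xY ->].
    rewrite (_ : [set x] = pblock P x) ?pblock_in //; apply/setP => y.
    rewrite inE; apply/eqP/idP => [->|/pblock_singleton->//]; first exact: same_refl.
    exact/Dtriv/(subsetP YD).
  have Ssize : sizes S = nseq s 1.
    have -> : s = size (sizes S).
      by rewrite size_map -cardE card_imset //; exact: set1_inj.
    apply/all_pred1P/allP => _ /mapP[B + ->]; rewrite mem_enum => /imsetP[x _ ->].
    by rewrite /= cards1.
  have S0 : S != set0 by rewrite -card_gt0 card_imset ?Ys 1?ltnW //; exact: set1_inj.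
  have [R [RE PR Rs]] := merge_exists SP S0.
  have EP : perm_eq (nseq s 1 ++ sizes (blocks P :\: S)) (r ++ s :: nseq t 1).
    by rewrite -Ssize -(permPl (sizesD SP)) -Ela -Pla perm_sym perm_sizes.
  (* Compare the numbers of ones: [r] has none, since its entries are at least [s]. *)
  have st : s <= t.
    have := seq.permP EP (pred1 1); rewrite !count_cat /= !count_nseq /= !mul1n.
    have /eqP -> : count (pred1 1) r == 0.
      by rewrite -leqn0 leqNgt -has_count; apply/hasPn => b /rs; rewrite /=; lia.
    by lia.
  have E2 : perm_eq (sizes (blocks P :\: S)) (r ++ s :: nseq (t - s) 1).
    rewrite -(perm_cat2l (nseq s 1)) (permPl EP) -{1}(subnKC st) nseqD.
    by rewrite -cat_rcons perm_catCA cat_rcons.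
  have ER : parts (ptype R) = r ++ s :: s :: nseq (t - s) 1.
    have /and3P[sR _ _] := partsP (ptype R); have /and3P[sla _ _] := partsP la.
    apply: sorted_geq_eq => //.
      by apply: (@sorted_split r s t); rewrite -?Ela // ltnW.
    rewrite (permPl (perm_sizes R)) (permPl Rs) Ssize sumn_nseq mul1n.
    by rewrite perm_sym -cat1s perm_catCA perm_cons perm_sym.
  exists (ptype R); first by right; exists t, s, r; rewrite s2.
  have coverD : cover S \subset D.
    by apply/bigcupsP => _ /imsetP[x xY ->]; rewrite sub1set (subsetP YD).
  apply: ppreceqI; first exact: merge_finer RE PQ QD coverD.
  (* The split keeps every part of [la] above 1, so the bounds known for [P] carry over to [R]. *)
  move=> C QC C2; have [b bla /andP[b2 bC]] := big _ QC C2.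
  have /mem_ptype[B RB Bb] : b \in parts (ptype R).
    move: bla; rewrite ER Ela !mem_cat !inE => /or3P[->|->|]; rewrite ?orbT //.
    by rewrite mem_nseq => /andP[_ /eqP b1]; rewrite b1 in b2.
  by exists B; rewrite // Bb b2.
have nontrivQ D : D \in blocks Q -> 1 < #|D| ->
    exists2 x, x \in D & 1 < #|pblock P x|.
  move=> QD D2; have := nontriv D QD; rewrite D2 /= => /forall_inPn[x xD].
  by rewrite -leqNgt; exists x.
have /existsP[x /existsP[y /andP[xyQ xyP]]] :
    [exists x, exists y, same Q x y && ~~ same P x y].
  apply: contraNT PNQ => /existsPn H; apply/finer_sameP => x y xy.
  by have /existsPn/(_ y) := H x; rewrite xy negbK.
set D := pblock Q x; have QD : D \in blocks Q := pblock_in Q x.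
have xD : x \in D := same_refl Q x.
have [|z zD zP] := nontrivQ D QD.
  apply/card_gt1P; exists x, y; split=> //.
  by apply: contraNneq xyP => ->; exact: same_refl.
(* [x] and [y] lie in different blocks of [P], so one of them is outside the block of [z]. *)
have [w wD wz] : exists2 w, w \in D & ~~ same P z w.
  have [zx|?] := boolP (same P z x); last by exists x.
  exists y => //; apply: contra xyP; apply: same_trans; by rewrite same_sym.
set A := pblock P z in zP; pose B := pblock P w.
have AB : A \notin [set B] by rewrite inE -sameE.
pose S := A |: [set B].
have SP : S \subset blocks P by rewrite subUset !sub1set !pblock_in.
have S0 : S != set0 by apply/set0Pn; exists A; exact: setU11.
have Ssize : perm_eq (sizes S) [:: #|A|; #|B|].
  by rewrite (permPl (sizesU1 AB)) /sizes enum_set1.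
have [R [RE PR Rs]] := merge_exists SP S0.
have RQ : finer R Q.
  apply: (merge_finer RE PQ QD); apply/bigcupsP => C /setU1P[->|/set1P->].
    by rewrite -(pblock_def QD zD); exact: (finerP _ _ PQ).
  by rewrite -(pblock_def QD wD); exact: (finerP _ _ PQ).
exists (ptype R).
  left; exists #|A|, #|B|, (sizes (blocks P :\: S)); split => //.
    rewrite -Pla (permPl (perm_sizes P)) (permPl (sizesD SP)).
    by rewrite -[_ :: _ :: _]/([:: _; _] ++ _) perm_cat2r.
  by rewrite (permPl (perm_sizes R)) (permPl Rs) (perm_sumn Ssize) /= addn0.
apply: ppreceqI => // C QC /(nontrivQ _ QC)[u uC uP].
exists (pblock R u); first exact: pblock_in.
rewrite (leq_trans uP (subset_leq_card (finerP _ _ PR u))) /=.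
by rewrite -(pblock_def QC uC); exact/subset_leq_card/(finerP _ _ RQ).
Qed.

(** * Merges and splits are covers *)

Lemma is_merge_covered mu la : is_merge mu la -> covered_by mu la.
Proof.
move=> m; split; first exact: is_merge_pprec.
move: m => [a [b [l [_ Ela Emu]]]] [nu [/pprec_size munu /pprec_size nula]].
move: nula munu; rewrite (perm_size Ela) (perm_size Emu) /= => nula munu.
by have := leq_trans munu nula; rewrite ltnn.
Qed.

(** A strict step from [la] to an intermediate [nu] factors through a merge or a split [c]. A merge
    raises the sum of the [a - s] above its value at [mu]; a split must be [mu] itself, and then
    [nu] cannot have more parts than [mu]. *)
Lemma is_split_covered mu la : is_split mu la -> covered_by mu la.
Proof.
move=> sp; split; first exact: is_split_pprec.
move: sp => [t [s [r [/andP[s2 st] Ela Emu]]]] [nu [munu nula]].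
have [c [[a [b [l [a2 Ela' Ec]]]] | [t' [s' [r' [/andP[s'2 _] Ela' Ec]]]]] nuc] :=
  pprec_through_cover nula.
  have mono := leq_trans (ppreceq_sum_subn s nuc) (ppreceq_sum_subn s munu.1).
  have ones m : \sum_(i <- nseq m 1) (i - s) = 0.
    by rewrite big1_seq // => i /andP[_ /nseqP[-> _]]; apply/eqP; rewrite subn_eq0 ltnW.
  have E : \sum_(i <- parts mu) (i - s) = \sum_(i <- parts la) (i - s).
    by rewrite Ela Emu !big_cat !big_cons /= !ones subnn.
  move: mono; rewrite E (perm_big _ Ela') (perm_big _ Ec) !big_cons /=.
  have sa : s <= a.
    have : a \in parts la by rewrite (perm_mem Ela') mem_head.
    have rs := parts_geq Ela.
    rewrite Ela mem_cat inE mem_nseq => /or3P[/rs|/eqP->|/andP[_ /eqP a1]] //.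
    by rewrite a1 in a2.
  have b0 : 0 < b by apply: (@parts_gt0 la); rewrite (perm_mem Ela') !inE eqxx orbT.
  lia.
have [rr' ss' tt'] := split_inj s2 s'2 (etrans (esym Ela) Ela').
have cmu : c = mu by apply/val_inj; rewrite /= Ec Emu rr' ss' tt'.
have musz := pprec_size munu.
have [nuE|] := ppreceq_size nuc; first by case: munu => _; apply; rewrite nuE cmu.
by rewrite cmu ltnNge (ltnW musz).
Qed.

(** * Translation into positions and lists *)

Lemma is_mergeP mu la :
  is_merge mu la <->
  exists i j : nat,
    [/\ i < size la, j < size la, i <> j,
        ~ (nth 0 la i = 1 /\ nth 0 la j = 1) &
        parts mu = merge_parts la i j].
Proof.
have /and3P[smu _ _] := partsP mu.
split=> [[a [b [l [a2 Ela Emu]]]] | [i [j [ila jla /eqP ij n1 Emu]]]].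
  (* The first two entries of the index permutation are the positions [i] and [j] of the merged
     parts. *)
  move: Ela; rewrite perm_sym => /(perm_iotaP 0)[[|i [|j Is]] //= pIs [Ea Eb El]].
  have mIs h : (h \in [:: i, j & Is]) = (h < size la).
    by rewrite (perm_mem pIs) mem_iota.
  have := iota_uniq 0 (size la); rewrite -(perm_uniq pIs) /= inE negb_or.
  move=> /and3P[/andP[ij iIs] jIs uIs].
  exists i, j; split; rewrite -?mIs ?inE ?eqxx ?orbT //.
  - by apply/eqP.
  - by rewrite -Ea => -[a1]; rewrite a1 in a2.
  apply: sorted_geq_eq => //; first by apply: sort_sorted => m n; exact: leq_total.
  rewrite (permPl Emu) /merge_parts perm_sym perm_sort -Ea -Eb perm_cons El.
  apply/perm_map/uniq_perm; rewrite ?filter_uniq ?iota_uniq // => h.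
  rewrite mem_filter mem_iota -mIs !inE.
  have [->|_] := eqVneq h i; first by rewrite (negPf iIs).
  by have [->|_] := eqVneq h j; first by rewrite (negPf jIs).
pose I := [seq h <- iota 0 (size la) | (h != i) && (h != j)].
have Ela : perm_eq (parts la) [seq nth 0 la h | h <- [:: i, j & I]].
  rewrite -{1}(mkseq_nth 0 la); apply/perm_map/uniq_perm; first exact: iota_uniq.
    by rewrite /= !inE !mem_filter !eqxx /= andbF orbF ij filter_uniq ?iota_uniq.
  move=> h; rewrite !inE mem_filter mem_iota /=.
  have [->|_] := eqVneq h i; first by rewrite ila.
  by have [->|_] := eqVneq h j; first by rewrite jla.
have {}Emu : perm_eq (parts mu)
    (nth 0 la i + nth 0 la j :: [seq nth 0 la h | h <- I]).
  by rewrite Emu perm_sort.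
have gt0 h : h < size la -> 0 < nth 0 la h by move=> hla; apply/parts_gt0/mem_nth.
have [i2|i2] := leqP 2 (nth 0 la i).
  by do 3!eexists; split; [exact: i2 | exact: Ela | exact: Emu].
(* The part at [i] is 1, so the one at [j] exceeds 1 and takes the role of [a]. *)
have [j2|j2] := leqP 2 (nth 0 la j); last first.
  by case: n1; have := gt0 i ila; have := gt0 j jla; lia.
exists (nth 0 la j), (nth 0 la i); eexists.
split; [exact: j2 | | rewrite addnC; exact: Emu].
by rewrite (permPl Ela) /= -[_ :: _ :: _]/([:: _] ++ [:: _] ++ _) perm_catCA.
Qed.

Lemma is_splitP mu la :
  is_split mu la <->
  exists (t s : nat) (r : seq nat),
    [/\ 2 <= s <= t,
        (r <> [::] -> s <= last 0 r),
        parts la = r ++ s :: nseq t 1 &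
        parts mu = r ++ s :: s :: nseq (t - s) 1].
Proof.
split=> [[t [s [r [st Ela Emu]]]] | [t [s [r [st _ Ela Emu]]]]]; exists t, s, r => //.
(* The bound on [last 0 r] is read off the sortedness of [la]. *)
split=> //; case: r Ela {Emu} => // a r Ela _.
by apply: (parts_geq Ela); exact: mem_last.
Qed.

End SetPartitions.

Theorem theorem4p1 (k : nat) (hk : 0 < k) (mu la : intpart k) :
  covered_by mu la <->
  (exists i j : nat,
     [/\ i < size la, j < size la, i <> j,
         ~ (nth 0 la i = 1 /\ nth 0 la j = 1) &
         parts mu = merge_parts la i j])
  \/
  (exists (t s : nat) (r : seq nat),
     [/\ 2 <= s <= t,
         (r <> [::] -> s <= last 0 r),
         parts la = r ++ s :: nseq t 1 &
         parts mu = r ++ s :: s :: nseq (t - s) 1]).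
Proof.
rewrite -is_mergeP -is_splitP; split=> [[mula nocover] | [|]].
(* If [c] differed from [mu], it would lie strictly between [mu] and [la]. *)
- have [c cla muc] := pprec_through_cover mula.
  have [->//|/eqP muNc] := eqVneq mu c.
  have cprec : pprec c la by case: cla; [exact: is_merge_pprec | exact: is_split_pprec].
  by case: nocover; exists c.
- exact: is_merge_covered.
- exact: is_split_covered.
Qed.
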